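(* Let $I=[a,b]$ with $a<b$. The Lie algebra $2$-cocycle $$\Omega\bigl(u(x)\partial_x,v(x)\partial_x\bigr)=\int_a^b\bigl(u_xv_{xx}-u_{xx}v_x\bigr)\,dx$$ on the Lie algebra $\mathrm{Vect}_0(I)$ is not a coboundary.
   Context: $\mathrm{Vect}_0(I)$ is the Lie algebra of $C^\infty$ vector fields $u(x)\partial_x$ on $I=[a,b]$ with $u(a)=u(b)=0$, with bracket $[u\partial_x,v\partial_x]=(uv_x-u_xv)\partial_x$. A $2$-cocycle $\Omega$ on $\mathrm{Vect}_0(I)$ is a coboundary if there exists a linear functional $\lambda:\mathrm{Vect}_0(I)\to\mathbb R$ such that $\Omega(X,Y)=\lambda([X,Y])$ for all $X,Y\in\mathrm{Vect}_0(I)$. *)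

(* Defs.v *)
From HB Require Import structures.
From mathcomp Require Import all_boot all_order all_algebra.
From mathcomp Require Import all_classical all_reals all_analysis.
From mathcomp Require Import ring.
Set Implicit Arguments.
Unset Strict Implicit.
Unset Printing Implicit Defensive.
Import Order.TTheory GRing.Theory Num.Theory.
Import numFieldNormedType.Exports.
Local Open Scope classical_set_scope.
Local Open Scope ring_scope.

HB.mixin Record isLieAlgebra (K : pzRingType) L of GRing.Lmodule K L := {
  lie : L -> L -> L;
  lie_linear_l : forall (k : K) (x y z : L),
    lie (k *: x + y) z = k *: lie x z + lie y z;
  lie_linear_r : forall (k : K) (x y z : L),
    lie z (k *: x + y) = k *: lie z x + lie z y;
  liexx : forall x : L, lie x x = 0;
  lie_jacobi : forall x y z : L,
    lie (lie x y) z + lie (lie y z) x + lie (lie z x) y = 0 }.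

#[short(type="lieAlgType")]
HB.structure Definition LieAlgebra (K : pzRingType) :=
  { L of GRing.Lmodule K L & isLieAlgebra K L }.

Definition is_2cocycle (K : pzRingType) (L : lieAlgType K)
    (Omega : L -> L -> K) : Prop :=
  [/\ forall (k : K) (x y z : L),
        Omega (k *: x + y) z = k * Omega x z + Omega y z,
      forall (k : K) (x y z : L),
        Omega z (k *: x + y) = k * Omega z x + Omega z y,
      forall x : L, Omega x x = 0
    & forall x y z : L,
        Omega (lie x y) z + Omega (lie y z) x + Omega (lie z x) y = 0].

Definition is_coboundary (K : pzRingType) (L : lieAlgType K)
    (Omega : L -> L -> K) : Prop :=
  exists lambda : {scalar L}, forall x y : L, Omega x y = lambda (lie x y).

Section IntervalDerivative.
Variables (R : realType) (a b : R).
Implicit Types (f g : R -> R) (x y : R).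

(* Limits at [x] are taken along [[a, b] \ {x}], hence are one-sided at the
   endpoints. *)
Definition itv_dnbhs x : set_system R := within [set` `[a, b]] x^'.

Definition diff_quot f x y : R := (f y - f x) / (y - x).

(* Functions on [[a, b]] are represented by functions on the line that vanish
   off [[a, b]], so that Leibniz equality is equality on [[a, b]]. *)
Definition itv_derive f x : R :=
  if x \in `[a, b] then lim (diff_quot f x y @[y --> itv_dnbhs x]) else 0.

Definition itv_smooth f : Prop :=
  forall n x, x \in `[a, b] ->
    cvg (diff_quot (iter n itv_derive f) x y @[y --> itv_dnbhs x]).

End IntervalDerivative.

Section Closure.
Variables (R : realType) (a b : R) (ab : a < b).
Implicit Types (f g : R -> R) (x y : R).
Local Notation W := (itv_dnbhs a b).
Local Notation D := (itv_derive a b).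
Local Notation dcvg f x := (cvg (diff_quot f x y @[y --> W x])).

Lemma itv_dnbhs_proper x : x \in `[a, b] -> ProperFilter (W x).
Proof.
move=> xab; apply: Build_ProperFilter_ex.
move=> P /nbhs_ballP[e /= e0 He].
move: xab; rewrite in_itv /= => /andP[ax xb].
have [xltb|blex] := ltP x b.
  pose y := x + Num.min (e / 2) (b - x).
  have m0 : 0 < Num.min (e / 2) (b - x) by rewrite lt_min divr_gt0//= subr_gt0.
  exists y; apply: He.
  - rewrite /ball /= /y opprD addrA subrr add0r normrN gtr0_norm//.
    by rewrite gt_min ltr_pdivrMr// ltr_pMr// ltr1n.
  - by rewrite /y -subr_eq0 addrAC subrr add0r gt_eqF.
  - rewrite /= in_itv /= /y (le_trans ax) ?lerDl ?(ltW m0)//=.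
    by rewrite -lerBrDl ge_min lexx orbT.
have altx : a < x by exact: lt_le_trans ab blex.
pose y := x - Num.min (e / 2) (x - a).
have m0 : 0 < Num.min (e / 2) (x - a) by rewrite lt_min divr_gt0//= subr_gt0.
exists y; apply: He.
- rewrite /ball /= /y opprB addrC subrK gtr0_norm//.
  by rewrite gt_min ltr_pdivrMr// ltr_pMr// ltr1n.
- by rewrite /y -subr_eq0 addrAC subrr add0r oppr_eq0 gt_eqF.
- rewrite /= in_itv /= /y; apply/andP; split.
    by rewrite lerBrDr addrC -lerBrDr ge_min lexx orbT.
  by rewrite (le_trans _ xb)// gerBl (ltW m0).
Qed.

Lemma itv_dnbhs_filter x : Filter (W x).
Proof. exact: within_filter. Qed.

#[local] Existing Instance itv_dnbhs_filter.

Lemma itv_derive_lim f x (l : R) : x \in `[a, b] ->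
  diff_quot f x y @[y --> W x] --> l -> D f x = l.
Proof.
move=> xab fl; rewrite /itv_derive xab.
have := itv_dnbhs_proper xab => PF.
exact: cvg_lim.
Qed.

Lemma itv_derive_cvg f x : x \in `[a, b] -> dcvg f x ->
  diff_quot f x y @[y --> W x] --> D f x.
Proof. by move=> xab; rewrite /itv_derive xab. Qed.

Lemma itv_derive_out f x : x \notin `[a, b] -> D f x = 0.
Proof. by rewrite /itv_derive => /negbTE ->. Qed.

Lemma diff_quot_linear k f g x (lf lg : R) :
  diff_quot f x y @[y --> W x] --> lf ->
  diff_quot g x y @[y --> W x] --> lg ->
  diff_quot (fun z => k * f z + g z) x y @[y --> W x] --> k * lf + lg.
Proof.
move=> fl gl; rewrite (_ : diff_quot _ x =
  (fun y => k * diff_quot f x y + diff_quot g x y)); last first.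
  by apply/funext => y; rewrite /diff_quot; ring.
by apply: cvgD => //; apply: cvgM => //; exact: cvg_cst.
Qed.

Lemma diff_quot_cont g x (lg : R) :
  diff_quot g x y @[y --> W x] --> lg -> g y @[y --> W x] --> g x.
Proof.
move=> gl.
have h : (diff_quot g x y * (y - x) + g x) @[y --> W x] --> lg * (x - x) + g x.
  apply: cvgD; last exact: cvg_cst.
  apply: cvgM => //; apply: cvgB; last exact: cvg_cst.
  apply: cvg_trans; last exact: (@cvg_id _ (nbhs x)).
  apply: cvg_trans; first exact: cvg_within.
  exact: cvg_within.
rewrite subrr mulr0 add0r in h.
apply: cvg_trans h; apply: near_eq_cvg.
have yx : W x [set y | y != x] 
  by apply: (@cvg_within _ x^'); exact: withinT.
near=> y; rewrite /diff_quot divfK ?subrK// subr_eq0.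
exact: (near yx y).
Unshelve. all: by end_near.
Qed.

Lemma diff_quot_mul f g x (lf lg : R) :
  diff_quot f x y @[y --> W x] --> lf ->
  diff_quot g x y @[y --> W x] --> lg ->
  diff_quot (fun z => f z * g z) x y @[y --> W x] --> lf * g x + f x * lg.
Proof.
move=> fl gl; rewrite (_ : diff_quot _ x =
  (fun y => diff_quot f x y * g y + f x * diff_quot g x y)); last first.
  by apply/funext => y; rewrite /diff_quot; ring.
apply: cvgD; apply: cvgM => //; [exact: diff_quot_cont gl|exact: cvg_cst].
Qed.

Lemma itv_derive_linear k f g x : x \in `[a, b] -> dcvg f x -> dcvg g x ->
  D (fun z => k * f z + g z) x = k * D f x + D g x.
Proof.
by move=> xab fc gc; apply: itv_derive_lim => //; apply: diff_quot_linear;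
  exact: itv_derive_cvg.
Qed.

Lemma itv_derive_mul f g x : x \in `[a, b] -> dcvg f x -> dcvg g x ->
  D (fun z => f z * g z) x = D f x * g x + f x * D g x.
Proof.
by move=> xab fc gc; apply: itv_derive_lim => //; apply: diff_quot_mul;
  exact: itv_derive_cvg.
Qed.

Inductive smooth_alg : (R -> R) -> Prop :=
| smooth_alg_base f : itv_smooth a b f -> smooth_alg f
| smooth_alg_lin k f g : smooth_alg f -> smooth_alg g ->
    smooth_alg (fun x => k * f x + g x)
| smooth_alg_mul f g : smooth_alg f -> smooth_alg g ->
    smooth_alg (fun x => f x * g x).

Lemma smooth_derive f : itv_smooth a b f -> itv_smooth a b (D f).
Proof. by move=> fs n x xab; rewrite -iterSr; exact: fs. Qed.

Lemma smooth_dcvg f x : itv_smooth a b f -> x \in `[a, b] -> dcvg f x.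
Proof. by move=> fs; exact: (fs 0%N). Qed.

Lemma smooth_alg_step f : smooth_alg f ->
  (forall x, x \in `[a, b] -> dcvg f x) /\ smooth_alg (D f).
Proof.
elim=> {f} [f fs|k f g _ [fc fD] _ [gc gD]|f g fA [fc fD] gA [gc gD]].
- split; first by move=> x; exact: smooth_dcvg.
  exact/smooth_alg_base/smooth_derive.
- split=> [x xab|].
    by apply/cvg_ex; eexists; apply: diff_quot_linear; [exact: fc|exact: gc].
  rewrite (_ : D _ = fun x => k * D f x + D g x); first exact: smooth_alg_lin.
  apply/funext => x; have [xab|xab] := boolP (x \in `[a, b]).
    by rewrite itv_derive_linear//; [exact: fc|exact: gc].
  by rewrite !itv_derive_out// mulr0 addr0.
- split=> [x xab|].
    by apply/cvg_ex; eexists; apply: diff_quot_mul; [exact: fc|exact: gc].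
  rewrite (_ : D _ = fun x => 1 * (D f x * g x) + f x * D g x).
    by apply: smooth_alg_lin; exact: smooth_alg_mul.
  apply/funext => x; rewrite mul1r; have [xab|xab] := boolP (x \in `[a, b]).
    by rewrite itv_derive_mul//; [exact: fc|exact: gc].
  by rewrite !itv_derive_out// mulr0 mul0r addr0.
Qed.

Lemma smooth_algP f : smooth_alg f -> itv_smooth a b f.
Proof.
move=> fA n; suff: smooth_alg (iter n D f) by case/smooth_alg_step.
by elim: n => //= n; case/smooth_alg_step.
Qed.

Lemma smooth0 : itv_smooth a b (fun=> 0).
Proof.
suff E : D (fun=> 0) = fun=> 0.
  move=> n x xab; rewrite (_ : iter n _ _ = fun=> 0); last first.
    by elim: n => //= n ->.
  apply/cvg_ex; exists 0; rewrite (_ : diff_quot _ x = fun=> 0).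
    exact: cvg_cst.
  by apply/funext => y; rewrite /diff_quot subrr mul0r.
apply/funext => x; have [xab|xab] := boolP (x \in `[a, b]); last first.
  by rewrite itv_derive_out.
apply: itv_derive_lim => //.
rewrite (_ : diff_quot _ x = fun=> 0); first exact: cvg_cst.
by apply/funext => y; rewrite /diff_quot subrr mul0r.
Qed.

End Closure.

Arguments smooth_derive {R a b f} _ _ _ _.

Section Vect0.
Variables (R : realType) (a b : R) (ab : a < b).

Definition vect0_pred of a < b : {pred (R -> R)} := fun u => `[<
  [/\ itv_smooth a b u, u a = 0, u b = 0
    & forall x, x \notin `[a, b] -> u x = 0] >].

Lemma vect0P (u : R -> R) : reflect
  [/\ itv_smooth a b u, u a = 0, u b = 0
    & forall x, x \notin `[a, b] -> u x = 0]
  (u \in vect0_pred ab).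
Proof. exact: asboolP. Qed.

Lemma vect0_submod : @submod_closed R (R -> R^o) (vect0_pred ab).
Proof.
split; first by apply/vect0P; split=> //; exact: smooth0.
move=> k u v /vect0P[us ua ub uo] /vect0P[vs va vb vo]; apply/vect0P.
split; rewrite /= ?fctE.
- by apply: (smooth_algP ab); apply: (@smooth_alg_lin _ _ _ k);
    exact: smooth_alg_base.
- by rewrite /= ua va scaler0 addr0.
- by rewrite /= ub vb scaler0 addr0.
- by move=> x xo; rewrite /= uo// vo// scaler0 addr0.
Qed.

HB.instance Definition _ :=
  @GRing.isSubmodClosed.Build R (R -> R^o) (vect0_pred ab) vect0_submod.

(* [u] stands for the vector field u(x) d/dx on [[a, b]]. *)
Record vect0 := Vect0 { vect0_fun :> R -> R^o; _ : vect0_fun \in vect0_pred ab }.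

HB.instance Definition _ := [isSub for vect0_fun].
HB.instance Definition _ := [Choice of vect0 by <:].
HB.instance Definition _ := [SubChoice_isSubLmodule of vect0 by <:].

Local Notation D := (itv_derive a b).
Implicit Types u v w : vect0.

Definition bracket_fun (u v : R -> R) : R -> R :=
  fun x => u x * D v x - D u x * v x.

Lemma vect0_smooth u : itv_smooth a b u.
Proof. by case: u => u /= /vect0P[]. Qed.

Arguments vect0_smooth : clear implicits.

Lemma vect0_left u : u a = 0.
Proof. by case: u => u /= /vect0P[]. Qed.

Lemma vect0_right u : u b = 0.
Proof. by case: u => u /= /vect0P[]. Qed.

Lemma vect0_out u x : x \notin `[a, b] -> u x = 0.
Proof. by case: u => u /= /vect0P[? ? ?]; exact. Qed.

Lemma vect0_eq u v : (forall x, x \in `[a, b] -> u x = v x) -> u = v.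
Proof.
move=> uv; apply: val_inj; apply/funext => x /=.
by have [/uv//|xab] := boolP (x \in `[a, b]); rewrite !vect0_out.
Qed.

Lemma bracket_subproof u v : bracket_fun u v \in vect0_pred ab.
Proof.
apply/vect0P; split.
- rewrite (_ : bracket_fun u v = fun x => -1 * (D u x * v x) + u x * D v x).
    have bu := smooth_alg_base (vect0_smooth u).
    have bv := smooth_alg_base (vect0_smooth v).
    have bDu := smooth_alg_base (smooth_derive (vect0_smooth u)).
    have bDv := smooth_alg_base (smooth_derive (vect0_smooth v)).
    exact: (smooth_algP ab (smooth_alg_lin (-1) (smooth_alg_mul bDu bv)
      (smooth_alg_mul bu bDv))).
  by apply/funext => x; rewrite /bracket_fun; ring.
- by rewrite /bracket_fun !vect0_left mul0r mulr0 subrr.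
- by rewrite /bracket_fun !vect0_right mul0r mulr0 subrr.
- by move=> x xo; rewrite /bracket_fun !vect0_out// mul0r mulr0 subrr.
Qed.

Definition bracket u v : vect0 := Vect0 (bracket_subproof u v).

Lemma itv_derive_vect0_linear k u v x : x \in `[a, b] ->
  D (k *: u + v) x = k * D u x + D v x.
Proof.
move=> xab.
exact: (itv_derive_linear ab k xab (smooth_dcvg (vect0_smooth u) xab)
  (smooth_dcvg (vect0_smooth v) xab)).
Qed.

Lemma itv_derive_bracket u v x : x \in `[a, b] ->
  D (bracket u v) x = u x * D (D v) x - D (D u) x * v x.
Proof.
move=> xab.
have su := vect0_smooth u; have sv := vect0_smooth v.
have sDu := smooth_derive su; have sDv := smooth_derive sv.
apply: (itv_derive_lim ab xab).
rewrite (_ : diff_quot _ x = diff_quot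
  (fun z => -1 * (D u z * v z) + u z * D v z) x); last first.
  by apply/funext => y; rewrite /diff_quot /= /bracket_fun; ring.
rewrite [X in _ --> X](_ : _ = -1 * (D (D u) x * v x + D u x * D v x) +
  (D u x * D v x + u x * D (D v) x)); last by ring.
have cvgD f : itv_smooth a b f ->
    diff_quot f x y @[y --> itv_dnbhs a b x] --> D f x.
  by move=> sf; apply: itv_derive_cvg => //; exact: smooth_dcvg.
exact: (diff_quot_linear (diff_quot_mul (cvgD _ sDu) (cvgD _ sv))
  (diff_quot_mul (cvgD _ su) (cvgD _ sDv))).
Qed.

Lemma bracket_linear_l (k : R) u v w :
  bracket (k *: u + v) w = k *: bracket u w + bracket v w.
Proof.
apply: vect0_eq => x xab; rewrite /= /bracket_fun itv_derive_vect0_linear//.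
by rewrite !fctE /= /bracket_fun /GRing.scale /=; ring.
Qed.

Lemma bracketC u v : bracket u v = - bracket v u.
Proof. by apply: vect0_eq => x xab; rewrite /= !fctE /= /bracket_fun; ring. Qed.

Lemma bracket_linear_r (k : R) u v w :
  bracket w (k *: u + v) = k *: bracket w u + bracket w v.
Proof.
by rewrite bracketC bracket_linear_l (bracketC w u) (bracketC w v) scalerN opprD.
Qed.

Lemma bracketxx u : bracket u u = 0.
Proof. by apply: vect0_eq => x xab; rewrite /= /bracket_fun mulrC subrr. Qed.

Lemma bracket_jacobi u v w :
  bracket (bracket u v) w + bracket (bracket v w) u
  + bracket (bracket w u) v = 0.
Proof.
apply: vect0_eq => x xab.
have E p q r : bracket (bracket p q) r x = (p x * D q x - D p x * q x) * D r x
    - (p x * D (D q) x - D (D p) x * q x) * r x :> R.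
  by rewrite -itv_derive_bracket.
change (bracket (bracket u v) w x + bracket (bracket v w) u x
  + bracket (bracket w u) v x = 0 :> R).
rewrite !E.
move: (u x : R) (v x : R) (w x : R) (D u x) (D v x) (D w x).
move: (D (D u) x) (D (D v) x) (D (D w) x) => *; ring.
Qed.

HB.instance Definition _ := isLieAlgebra.Build R vect0
  bracket_linear_l bracket_linear_r bracketxx bracket_jacobi.

Definition Omega u v : R := \int[lebesgue_measure]_(x in `[a, b])
  (D u x * D (D v) x - D (D u) x * D v x).

End Vect0.

(* Main.v *)
Require Import Defs.
From mathcomp Require Import all_boot all_order all_algebra.
From mathcomp Require Import all_classical all_reals all_analysis.
From mathcomp Require Import ring lra.

(** The integrand u' v'' - u'' v' has to be shown to define a cocycle which no
linear functional of the bracket can reproduce.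

Cocycle identity.  Write [u, v] = u v' - u' v.  The cyclic sum of the
integrands of Omega([u, v], w) is the derivative of
  W = u'' [v, w] + v'' [w, u] + w'' [u, v],
which vanishes at a and b because brackets do, so the cyclic sum of the
integrals is W(b) - W(a) = 0 ([Omega_jacobi]).  This rests on the fundamental
theorem of calculus for derivatives taken relative to [[a, b]]
([Rintegral_itv_derive]).

Non-triviality.  If Omega were lambda o [.,.], then two pairs of fields with
the same bracket would have the same value under Omega.  Put
q = (x - a)(x - b), so that q f vanishes at the endpoints for every polynomial
f.  Then [q f, q g] = q^2 (f g' - f' g), so a primitive h of f g' - f' g gives
[q f, q g] = [q, q h] ([bracket_poly_field_eq]).  On the other hand
  Omega(q f, q g) - Omega(q, q h) = \int q^2 (f' g'' - f'' g'),
with equality already between the integrands ([Omega_poly_field_diff]).  For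
f = s, g = 15 s^2, h = 5 s^3 with s = x - a, the right-hand side is the
integral of 30 q^2, which is (b - a)^5 and hence nonzero. *)

Set Implicit Arguments.
Unset Strict Implicit.
Unset Printing Implicit Defensive.
Import Order.TTheory GRing.Theory Num.Theory.
Import numFieldNormedType.Exports.
Local Open Scope classical_set_scope.
Local Open Scope ring_scope.

(** * Differentiation and integration of smooth functions on [[a, b]] *)

Section Calculus.
Variables (R : realType) (a b : R) (ab : a < b).
Implicit Types (f g : R -> R) (x : R).
Local Notation D := (itv_derive a b).
Local Notation smooth := (itv_smooth a b).

Lemma itv_smooth_lin (k : R) f g : smooth f -> smooth g ->
  smooth (fun x => k * f x + g x).
Proof.
by move=> sf sg; apply: (smooth_algP ab); apply: smooth_alg_lin;
  exact: smooth_alg_base.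
Qed.

Lemma itv_smoothM f g : smooth f -> smooth g -> smooth (fun x => f x * g x).
Proof.
by move=> sf sg; apply: (smooth_algP ab); apply: smooth_alg_mul;
  exact: smooth_alg_base.
Qed.

Lemma itv_smoothD f g : smooth f -> smooth g -> smooth (fun x => f x + g x).
Proof.
move=> sf sg; rewrite (_ : (fun x => _) = fun x => 1 * f x + g x).
  exact: itv_smooth_lin.
by apply/funext => x; rewrite mul1r.
Qed.

Lemma itv_smoothB f g : smooth f -> smooth g -> smooth (fun x => f x - g x).
Proof.
move=> sf sg; rewrite (_ : (fun x => _) = fun x => -1 * g x + f x).
  exact: itv_smooth_lin.
by apply/funext => x; ring.
Qed.

Lemma itv_deriveD f g x : smooth f -> smooth g -> x \in `[a, b] ->
  D (fun z => f z + g z) x = D f x + D g x.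
Proof.
move=> sf sg xab; rewrite (_ : (fun z => _) = fun z => 1 * f z + g z).
  by rewrite (itv_derive_linear ab 1 xab (smooth_dcvg sf xab)
    (smooth_dcvg sg xab)) mul1r.
by apply/funext => z; rewrite mul1r.
Qed.

Lemma itv_deriveM f g x : smooth f -> smooth g -> x \in `[a, b] ->
  D (fun z => f z * g z) x = D f x * g x + f x * D g x.
Proof. by move=> sf sg xab; apply: itv_derive_mul => //; exact: smooth_dcvg. Qed.

Lemma itv_smooth_continuous f : smooth f -> {within `[a, b], continuous f}.
Proof.
move=> sf; apply/subspace_continuousP => x /= xab.
have /cvg_ex[l fl] := smooth_dcvg sf xab.
(* The punctured limit is known; the value at x itself is added here. *)
move=> U Ux; have := diff_quot_cont fl Ux.
rewrite /itv_dnbhs /nbhs /= /within /= /dnbhs /=.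
rewrite !near_withinE; apply: filterS => y /= H yab.
have [->|yx] := eqVneq y x; first exact: nbhs_singleton.
exact: H.
Qed.

(** Near an interior point the restriction of the limit to [[a, b]] is void, so
the derivative relative to [[a, b]] is the usual one. *)
Lemma is_derive_itv_derive f x : smooth f -> x \in `]a, b[ ->
  is_derive x 1 f (D f x).
Proof.
move=> sf xab.
have xab' : x \in `[a, b] by exact: subset_itv_oo_cc.
have fl := itv_derive_cvg xab' (smooth_dcvg sf xab').
suff h : (fun h => h^-1 *: ((f \o shift x) (h *: 1) - f x)) @ 0^' --> D f x.
  by apply: DeriveDef; [apply/cvg_ex; exists (D f x)|exact: cvg_lim].
move=> U /fl; rewrite /itv_dnbhs /nbhs /= /within /=.
have oo : \forall y \near x, y \in `]a, b[ by exact: near_in_itvoo.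
move=> H.
have {H} : \forall y \near x, y != x -> U (diff_quot f x y).
  by apply: filterS2 oo H => y /subset_itv_oo_cc yab H yx; exact: H.
rewrite (near_shift 0) subr0 /= => {}H.
(* The difference quotient in the increment h = y - x. *)
change (\forall h \near (0 : R), h != 0 ->
  U (h^-1 *: (f (h%:A + x) - f x))).
apply: filterS H => h /= H h0; have := H.
by rewrite /diff_quot /= addrK [h *: 1]mulr1 -subr_eq0 addrK mulrC; exact.
Unshelve. all: by end_near.
Qed.

Lemma itv_smooth_integrable f : smooth f ->
  lebesgue_measure.-integrable `[a, b] (EFin \o f).
Proof.
move=> sf; apply: continuous_compact_integrable; first exact: segment_compact.
exact: itv_smooth_continuous.
Qed.

Lemma Rintegral_itv_smoothD f g : smooth f -> smooth g ->
  \int[lebesgue_measure]_(x in `[a, b]) (f x + g x) =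
  \int[lebesgue_measure]_(x in `[a, b]) f x +
  \int[lebesgue_measure]_(x in `[a, b]) g x.
Proof. by move=> sf sg; rewrite RintegralD//; exact: itv_smooth_integrable. Qed.

Lemma Rintegral_itv_smoothZ k f : smooth f ->
  \int[lebesgue_measure]_(x in `[a, b]) (k * f x) =
  k * \int[lebesgue_measure]_(x in `[a, b]) f x.
Proof. by move=> sf; rewrite RintegralZl//; exact: itv_smooth_integrable. Qed.

Lemma itv_smoothZ (k : R) f : smooth f -> smooth (fun x => k * f x).
Proof.
move=> sf; rewrite (_ : (fun x => _) = fun x => k * f x + 0).
  by apply: itv_smooth_lin => //; exact: smooth0.
by apply/funext => x; rewrite addr0.
Qed.

(** Fundamental theorem of calculus. *)
Lemma Rintegral_itv_derive f : smooth f ->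
  \int[lebesgue_measure]_(x in `[a, b]) D f x = f b - f a.
Proof.
move=> sf; rewrite /Rintegral (@continuous_FTC2 _ _ f) //.
- exact/itv_smooth_continuous/smooth_derive.
- have /(continuous_within_itvP _ ab)[_ fa fb] := itv_smooth_continuous sf.
  split => // x xab.
  by have := is_derive_itv_derive sf xab => -[].
- move=> x xab; rewrite derive1E.
  by have := is_derive_itv_derive sf xab => -[].
Qed.

Lemma itv_derive_cvg_horner (p : {poly R}) x :
  diff_quot (horner p) x y @[y --> itv_dnbhs a b x] --> p^`().[x].
Proof.
have Fx := itv_dnbhs_filter a b x.
have cst (c : R) : diff_quot (fun=> c) x y @[y --> itv_dnbhs a b x] --> (0 : R).
  rewrite (_ : diff_quot _ x = fun=> 0); first exact: cvg_cst.
  by apply/funext => y; rewrite /diff_quot subrr mul0r.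
have idx : diff_quot id x y @[y --> itv_dnbhs a b x] --> (1 : R).
  have yx : itv_dnbhs a b x [set y | y != x].
    by apply: (@cvg_within _ x^'); exact: withinT.
  apply: (cvg_trans _ (@cvg_cst _ (1 : R) _ (itv_dnbhs a b x) _)).
  apply: near_eq_cvg; near=> y.
  by rewrite /diff_quot divff// subr_eq0; exact: (near yx y).
elim/poly_ind: p => [|p c ih].
  rewrite deriv0 horner0 (_ : horner 0 = fun=> 0) //.
  by apply/funext => y; rewrite horner0.
rewrite (_ : horner _ = fun y => 1 * (p.[y] * y) + c); last first.
  by apply/funext => y; rewrite !hornerE.
rewrite derivD derivM derivX derivC !hornerE.
have := diff_quot_linear (k := 1) (diff_quot_mul ih idx) (cst c).
by rewrite mul1r mulr1 addr0.
Unshelve. all: by end_near.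
Qed.

End Calculus.

(** * The cocycle identities *)

(** The cyclic sum of the integrands is the derivative of
u'' [v, w] + v'' [w, u] + w'' [u, v], as an identity between the values at one
point of u, v, w and their first three derivatives. *)
Fact cyclic_sum_jet (R : comPzRingType) (u0 v0 w0 u1 v1 w1 u2 v2 w2 u3 v3 w3 : R) :
  (u0 * v2 - u2 * v0) * w2 - (u1 * v2 + u0 * v3 - (u3 * v0 + u2 * v1)) * w1
  + ((v0 * w2 - v2 * w0) * u2
     - (v1 * w2 + v0 * w3 - (v3 * w0 + v2 * w1)) * u1)
  + ((w0 * u2 - w2 * u0) * v2
     - (w1 * u2 + w0 * u3 - (w3 * u0 + w2 * u1)) * v1)
  = u3 * (v0 * w1 - v1 * w0) + u2 * (v0 * w2 - v2 * w0)
  + (v3 * (w0 * u1 - w1 * u0) + v2 * (w0 * u2 - w2 * u0))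
  + (w3 * (u0 * v1 - u1 * v0) + w2 * (u0 * v2 - u2 * v0)).
Proof. ring. Qed.

Section Cocycle.
Variables (R : realType) (a b : R) (ab : a < b).
Implicit Types (u v w : vect0 ab) (x : R).
Local Notation D := (itv_derive a b).
Local Notation smooth := (itv_smooth a b).

Let sm u : smooth u. Proof. exact: vect0_smooth. Qed.
Let smD f : smooth f -> smooth (D f). Proof. exact: smooth_derive. Qed.
Let smc f x : smooth f -> x \in `[a, b] ->
  cvg (diff_quot f x y @[y --> itv_dnbhs a b x]).
Proof. exact: smooth_dcvg. Qed.

Lemma itv_derive2_vect0_linear (k : R) u v x : x \in `[a, b] ->
  D (D (k *: u + v)) x = k * D (D u) x + D (D v) x.
Proof.
move=> xab; rewrite (_ : D (k *: u + v) = fun x => k * D u x + D v x).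
  by rewrite (itv_derive_linear ab k xab (smc (smD (@sm u)) xab)
    (smc (smD (@sm v)) xab)).
apply/funext => y; have [yab|yab] := boolP (y \in `[a, b]).
  exact: itv_derive_vect0_linear.
by rewrite !itv_derive_out// mulr0 addr0.
Qed.

Lemma itv_derive2_bracket u v x : x \in `[a, b] ->
  D (D (bracket u v)) x = D u x * D (D v) x + u x * D (D (D v)) x
    - (D (D (D u)) x * v x + D (D u) x * D v x).
Proof.
move=> xab.
rewrite (_ : D (bracket u v) = fun x => -1 * (D (D u) x * v x) + u x * D (D v) x).
  have sD2 (w : vect0 ab) : smooth (D (D w)) by exact: smD (smD (@sm w)).
  have s1 := itv_smoothM ab (sD2 u) (@sm v).
  have s2 := itv_smoothM ab (@sm u) (sD2 v).
  rewrite (itv_derive_linear ab (-1) xab (smc s1 xab) (smc s2 xab)).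
  rewrite (itv_deriveM ab (sD2 u) (@sm v) xab).
  rewrite (itv_deriveM ab (@sm u) (sD2 v) xab).
  by rewrite mulN1r addrC.
apply/funext => y; have [yab|yab] := boolP (y \in `[a, b]).
  by rewrite itv_derive_bracket// mulN1r addrC.
by rewrite !itv_derive_out// mul0r !mulr0 addr0.
Qed.

(** The integrand of [Omega]. *)
Let omega u v x : R := D u x * D (D v) x - D (D u) x * D v x.

Let omega_smooth u v : smooth (omega u v).
Proof.
have sD2 (w : vect0 ab) : smooth (D (D w)) by exact: smD (smD (@sm w)).
exact: (itv_smoothB ab (itv_smoothM ab (smD (@sm u)) (sD2 v))
  (itv_smoothM ab (sD2 u) (smD (@sm v)))).
Qed.

Let OmegaE u v : Omega u v = \int[lebesgue_measure]_(x in `[a, b]) omega u v x.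
Proof. by []. Qed.

Lemma Omega_linear_l (k : R) u v w :
  Omega (k *: u + v) w = k * Omega u w + Omega v w.
Proof.
have sk : smooth (fun x => k * omega u w x) by exact: (itv_smoothZ ab).
rewrite !OmegaE -Rintegral_itv_smoothZ// -Rintegral_itv_smoothD//.
apply: eq_Rintegral => x; rewrite inE /= => xab.
rewrite /omega itv_derive_vect0_linear// itv_derive2_vect0_linear//.
move: (D u x) (D v x) (D w x) (D (D u) x) (D (D v) x) (D (D w) x) => *; ring.
Qed.

Lemma OmegaC u v : Omega u v = - Omega v u.
Proof.
rewrite -mulN1r !OmegaE -Rintegral_itv_smoothZ//.
apply: eq_Rintegral => x _; rewrite /omega mulN1r opprB.
by congr (_ - _); exact: mulrC.
Qed.

Lemma Omega_linear_r (k : R) u v w :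
  Omega w (k *: u + v) = k * Omega w u + Omega w v.
Proof.
rewrite (OmegaC w (k *: u + v)) Omega_linear_l (OmegaC w u) (OmegaC w v).
by move: (Omega u w) (Omega v w) => A B; rewrite mulrN opprD.
Qed.

Lemma Omegaxx u : Omega u u = 0.
Proof.
by have := OmegaC u u; move: (Omega u u) => A; lra.
Qed.

Lemma Omega_jacobi u v w :
  Omega (bracket u v) w + Omega (bracket v w) u + Omega (bracket w u) v = 0.
Proof.
have sO2 : smooth (fun x => omega (bracket u v) w x + omega (bracket v w) u x).
  by apply: (itv_smoothD ab); exact: omega_smooth.
pose W x : R := D (D u) x * bracket v w x + D (D v) x * bracket w u x
  + D (D w) x * bracket u v x.
have sW1 (p q r : vect0 ab) : smooth (fun x => D (D p) x * bracket q r x).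
  exact: (itv_smoothM ab (smD (smD (@sm p))) (@sm (bracket q r))).
have sW2 := itv_smoothD ab (sW1 u v w) (sW1 v w u).
have sW : smooth W := itv_smoothD ab sW2 (sW1 w u v).
have z (A B C : R) : A * 0 + B * 0 + C * 0 = 0 by rewrite !mulr0 !addr0.
have Wa : W a = 0.
  rewrite /W (vect0_left (bracket v w)) (vect0_left (bracket w u)).
  by rewrite (vect0_left (bracket u v)); exact: z.
have Wb : W b = 0.
  rewrite /W (vect0_right (bracket v w)) (vect0_right (bracket w u)).
  by rewrite (vect0_right (bracket u v)); exact: z.
rewrite -[RHS](subrr 0) -{1}Wb -Wa -(Rintegral_itv_derive ab sW).
rewrite !OmegaE -Rintegral_itv_smoothD// -Rintegral_itv_smoothD//.
apply: eq_Rintegral => x; rewrite inE /= => xab.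
have EW : D W x = D (D (D u)) x * bracket v w x + D (D u) x * D (bracket v w) x
  + (D (D (D v)) x * bracket w u x + D (D v) x * D (bracket w u) x)
  + (D (D (D w)) x * bracket u v x + D (D w) x * D (bracket u v) x).
  rewrite (itv_deriveD ab sW2 (sW1 w u v) xab).
  rewrite (itv_deriveD ab (sW1 u v w) (sW1 v w u) xab).
  rewrite (itv_deriveM ab (smD (smD (@sm u))) (@sm (bracket v w)) xab).
  rewrite (itv_deriveM ab (smD (smD (@sm v))) (@sm (bracket w u)) xab).
  by rewrite (itv_deriveM ab (smD (smD (@sm w))) (@sm (bracket u v)) xab).
rewrite EW /omega.
rewrite (itv_derive_bracket u v xab) (itv_derive_bracket v w xab).
rewrite (itv_derive_bracket w u xab) (itv_derive2_bracket u v xab).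
rewrite (itv_derive2_bracket v w xab) (itv_derive2_bracket w u xab).
have bE (p q : vect0 ab) : bracket p q x = p x * D q x - D p x * q x :> R by [].
rewrite (bE u v) (bE v w) (bE w u).
exact: cyclic_sum_jet.
Qed.

Lemma Omega_2cocycle : is_2cocycle (@Omega R a b ab).
Proof.
split; [exact: Omega_linear_l|exact: Omega_linear_r|exact: Omegaxx|].
exact: Omega_jacobi.
Qed.

End Cocycle.

(** * Polynomial vector fields and non-triviality *)

Section PolynomialFields.
Variables (R : realType) (a b : R) (ab : a < b).
Implicit Types (p f g h : {poly R}) (x : R).
Local Notation D := (itv_derive a b).
Local Notation smooth := (itv_smooth a b).

(** The polynomial function p on [[a, b]], extended by 0 off [[a, b]], which is
how functions on the interval are represented. *)
Definition itv_poly p x : R := if x \in `[a, b] then p.[x] else 0.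

Lemma itv_poly_cvg p x : x \in `[a, b] ->
  diff_quot (itv_poly p) x y @[y --> itv_dnbhs a b x] --> p^`().[x].
Proof.
move=> xab; apply: (cvg_trans _ (@itv_derive_cvg_horner R a b p x)).
have Fx := itv_dnbhs_filter a b x.
apply: near_eq_cvg; rewrite /itv_dnbhs near_withinE.
by near=> y => yab; rewrite /diff_quot /itv_poly xab yab.
Unshelve. all: by end_near.
Qed.

Lemma itv_derive_poly p : D (itv_poly p) = itv_poly p^`().
Proof.
apply/funext => x; rewrite {2}/itv_poly; case: ifPn => xab; last first.
  exact: itv_derive_out.
exact: (itv_derive_lim ab xab (itv_poly_cvg xab)).
Qed.

Lemma itv_poly_smooth p : smooth (itv_poly p).
Proof.
move=> n x xab; have -> : iter n D (itv_poly p) = itv_poly p^`(n).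
  by elim: n => //= n ->; rewrite itv_derive_poly.
by apply/cvg_ex; exists (p^`(n)^`()).[x]; exact: itv_poly_cvg.
Qed.

(** A polynomial whose multiples all vanish at a and b. *)
Definition endpoint_poly : {poly R} := ('X - a%:P) * ('X - b%:P).
Local Notation q := endpoint_poly.

Fact poly_field_subproof f : itv_poly (q * f) \in vect0_pred ab.
Proof.
apply/vect0P; split; first exact: itv_poly_smooth.
- by rewrite /itv_poly; case: ifP; rewrite // !hornerE subrr !mul0r.
- by rewrite /itv_poly; case: ifP; rewrite // !hornerE subrr mulr0 mul0r.
- by move=> x /negbTE xab; rewrite /itv_poly xab.
Qed.

(** The vector field q f d/dx, where q = (x - a)(x - b). *)
Definition poly_field f : vect0 ab := Vect0 (poly_field_subproof f).

Lemma bracket_poly_field f g :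
  bracket (poly_field f) (poly_field g) =
  poly_field (q * (f * g^`() - f^`() * g)).
Proof.
apply: vect0_eq => x xab; rewrite /= /bracket_fun /= !itv_derive_poly.
by rewrite /itv_poly xab -!hornerM -hornerN -hornerD; congr (_.[x]);
  rewrite !derivM; ring.
Qed.

Lemma Omega_poly_field f g :
  Omega (poly_field f) (poly_field g) = \int[lebesgue_measure]_(x in `[a, b])
    itv_poly ((q * f)^`() * (q * g)^`()^`()
              - (q * f)^`()^`() * (q * g)^`()) x.
Proof.
apply: eq_Rintegral => x; rewrite inE /= => xab.
by rewrite !itv_derive_poly /itv_poly xab !(hornerM, hornerN, hornerD).
Qed.

(** The pairs (q f, q g) and (q, q h) have the same bracket
([bracket_poly_field_eq] below), but their integrands under [Omega] differ
pointwise by q^2 (f' g'' - f'' g'). *)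
Lemma Omega_poly_field_diff f g h : h^`() = f * g^`() - f^`() * g ->
  Omega (poly_field f) (poly_field g) =
  Omega (poly_field 1) (poly_field h) + \int[lebesgue_measure]_(x in `[a, b])
    itv_poly (q ^+ 2 * (f^`() * g^`()^`() - f^`()^`() * g^`())) x.
Proof.
move=> dh; rewrite !Omega_poly_field.
rewrite -Rintegral_itv_smoothD; try exact: itv_poly_smooth.
apply: eq_Rintegral => x; rewrite inE /= => xab.
rewrite /itv_poly xab -hornerD; congr (_.[x]).
rewrite !mulr1 !(derivM, derivD) dh !(derivM, derivD, derivN).
ring.
Qed.

Lemma bracket_poly_field_eq f g h : h^`() = f * g^`() - f^`() * g ->
  bracket (poly_field f) (poly_field g) = bracket (poly_field 1) (poly_field h).
Proof.
by move=> dh; rewrite !bracket_poly_field dh derivC; congr poly_field; ring.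
Qed.

Lemma Omega_not_coboundary : ~ is_coboundary (@Omega R a b ab).
Proof.
case=> lambda Ol.
pose s : {poly R} := 'X - a%:P.
have ds : s^`() = 1 by rewrite derivXsubC.
have d1 : (1 : {poly R})^`() = 0 by rewrite derivC.
pose f := s; pose g := s * s *+ 15; pose h := s * s * s *+ 5.
have dh : h^`() = f * g^`() - f^`() * g.
  by rewrite /h /f /g !(derivMn, derivM, ds); ring.
pose L := b - a.
(* A primitive of 30 q^2 = 30 s^2 (s - L)^2. *)
pose P := s * s * s * (s * s *+ 6 - L%:P * s *+ 15 + L%:P * L%:P *+ 10).
have sL : 'X - b%:P = s - L%:P by rewrite /s /L polyCB; ring.
have dP : P^`() = q ^+ 2 * (f^`() * g^`()^`() - f^`()^`() * g^`()).
  rewrite /P /q sL -/s /f /g.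
  rewrite !(derivMn, derivM, derivD, derivN, ds, derivC, derivX, d1, deriv0); ring.
have := Omega_poly_field_diff dh.
rewrite !Ol /lie /= (bracket_poly_field_eq dh) -dP -itv_derive_poly.
rewrite (Rintegral_itv_derive ab (@itv_poly_smooth P)).
rewrite /itv_poly !in_itv /= !lexx !(ltW ab) /=.
have -> : P.[b] - P.[a] = L ^+ 5.
  have PE x : P.[x] = (x - a) * (x - a) * (x - a) * ((x - a) * (x - a) *+ 6
      - L * (x - a) *+ 15 + L * L *+ 10).
    by rewrite /P /s !(hornerM, hornerD, hornerN, hornerMn, hornerC, hornerX).
  by rewrite !PE subrr -/L; ring.
have L5 : 0 < L ^+ 5 by rewrite exprn_gt0// subr_gt0.
move: (lambda _) L5 => A; move: (L ^+ 5) => B; lra.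
Qed.

End PolynomialFields.

Theorem theorem2p3 (R : realType) (a b : R) (ab : a < b) :
  is_2cocycle (@Omega R a b ab) /\ ~ is_coboundary (@Omega R a b ab).
Proof. by split; [exact: Omega_2cocycle|exact: Omega_not_coboundary]. Qed.
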